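(* Let $(K,<)$ be a nonarchimedean ordered field with natural valuation $v$, and let $R_w\neq R_v$ be a convex valuation ring of $(K,<)$, where $w$ is the corresponding coarsening of $v$. a) $R_w$ lies in the principal rank $\mathcal R^{\mathrm{pr}}$ if and only if for some $b$ in the residue field $Kw$, the sequence $(b^n)_{n\in\mathbb N}$ is cofinal in $Kw$. The principal rank is a singleton (namely, $\mathcal R^{\mathrm{pr}}=\{K\}$) if and only if $(a^n)_{n\in\mathbb N}$ is cofinal in $K$ for every positive infinite element $a\in K$. b) Assume in addition that $f$ is a strong $T_1$-exponential on $(K,<)$ and that $w$ is compatible with $f$. Then $R_w$ lies in the principal exponential rank $\mathcal R_f^{\mathrm{pr}}$ if and only if for some $b$ in the residue field $Kw$, the sequence $((fw)^n(b))_{n\in\mathbb N}$ is cofinal in $Kw$. The principal exponential rank is a singleton (namely, $\mathcal R_f^{\mathrm{pr}}=\{K\}$) if and only if $(f^n(a))_{n\in\mathbb N}$ is cofinal in $K$ for every positive infinite element $a\in K$.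
   Context: Valuations are written additively, with $w0=\infty$; $R_w$, $I_w$, $wK$, $Kw$ denote valuation ring, valuation ideal, value group and residue field of $w$. The natural valuation $v$ of an ordered field $(K,<)$ sends a nonzero $a$ to its archimedean class, with $va<vb$ iff $|a|>n|b|$ for all $n\in\mathbb N$; so $R_v=\{a:|a|\le n\text{ for some }n\in\mathbb N\}$ and $I_v$ is the set of infinitesimals. $K$ is nonarchimedean iff $v$ is nontrivial; the positive infinite elements are those of $K^{>0}\setminus R_v$. A coarsening of $v$ is a valuation $w$ with $R_w\supseteq R_v$; the coarsenings of $v$ (including $v$ and the trivial valuation) are precisely the valuations with convex valuation ring, and for each of them the ordering of $K$ induces an ordering on $Kw$ via the residue map. Put $\mathcal U_w^{>0}=\{a\in K:wa=0,\ a>0\}$ and $G_w=\{va:a\in K,\ wa=0\}$, a convex subgroup of $vK$. The rank $\mathcal R$ is the set of all valuation rings $R_w$ of coarsenings $w\ne v$ of $v$ (including $R_w=K$), ordered by inclusion. The principal rank $\mathcal R^{\mathrm{pr}}$ is the set of all $R_w\in\mathcal R$ such that $G_w$ is principal, i.e. there is $g\in vK$ such that $G_w$ is the smallest convex subgroup of $vK$ containing $g$. An exponential $f$ on $(K,<)$ is an isomorphism of ordered groups from $(K,+,0,<)$ onto $(K^{>0},\cdot,1,<)$. $w$ and $f$ are compatible if $f(R_w)=\mathcal U_w^{>0}$ and $f(I_w)=1+I_w$; then $f$ induces an exponential $fw$ on the ordered field $Kw$. $f$ is a $T_1$-exponential if $v$ is compatible with $f$ and $v(f(a)-1-a)>va$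 for all nonzero $a\in I_v$. $f$ is strong if for every $n\in\mathbb N$ and $a\in K$: $a>n^2\Rightarrow f(a)>a^n$. The exponential rank $\mathcal R_f$ is the set of all $R_w\in\mathcal R$ with $f(R_w)=\mathcal U_w^{>0}$. The principal exponential rank $\mathcal R_f^{\mathrm{pr}}$ is the set of all $R_w\in\mathcal R_f$ such that $G_w$ is $f$-principal, i.e. there is $g\in vK$ such that $G_w$ is the smallest among all convex subgroups $H$ of $vK$ that contain $g$ and satisfy: $va\in H\Rightarrow vf(a)\in H$ for all $a\in K$. $f^1(a)=f(a)$, $f^{n+1}(a)=f(f^n(a))$, and similarly for $fw$. A sequence is cofinal in an ordered field if every element of the field is $\le$ some member of the sequence. *)

(* Defs.v *)
From HB Require Import structures.
From mathcomp Require Import all_boot all_order all_algebra.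
From mathcomp Require Import ring_quotient generic_quotient.
From mathcomp Require Import boolp classical_sets ring.

Set Implicit Arguments.
Unset Strict Implicit.
Unset Printing Implicit Defensive.

Import Order.TTheory GRing.Theory Num.Theory.

Local Open Scope ring_scope.
Local Open Scope quotient_scope.
Local Open Scope classical_set_scope.

Record orderedGroup := OrderedGroup {
  ogroup_sort :> porderZmodType;
  ogroup_total : total (<=%R : rel ogroup_sort);
  ogroup_leD2r : forall x y z : ogroup_sort, x <= y -> x + z <= y + z
}.

(* [option G] is G with a top element: [None] is infinity. *)
Section WithInfinity.
Variable G : orderedGroup.
Implicit Types (x y : option G) (g h : G).

Definition vle x y : bool :=
  match x, y with
  | _, None => true
  | None, Some _ => false
  | Some g, Some h => g <= h
  end.

Definition vlt x y : bool := ~~ vle y x.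

Definition vmin x y : option G := if vle x y then x else y.

Definition vadd x y : option G :=
  match x, y with
  | Some g, Some h => Some (g + h)
  | _, _ => None
  end.

Lemma vlexx x : vle x x.
Proof. by case: x => [g|] //=. Qed.

Lemma vle_trans x y z : vle x y -> vle y z -> vle x z.
Proof. by case: x y z => [a|] [b|] [c|] //=; apply: le_trans. Qed.

Lemma vle_total x y : vle x y || vle y x.
Proof. by case: x y => [a|] [b|] //=; apply: ogroup_total. Qed.

Lemma vltW x y : vlt x y -> vle x y.
Proof. by rewrite /vlt; case/orP: (vle_total x y) => ->. Qed.

Lemma vle_lt_trans x y z : vle x y -> vlt y z -> vlt x z.
Proof. by move=> xy; apply: contra => zx; apply: vle_trans zx xy. Qed.

Lemma vlt_le_trans x y z : vlt x y -> vle y z -> vlt x z.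
Proof. by move=> + yz; apply: contra => zx; apply: vle_trans yz zx. Qed.

Lemma vle_anti x y : vle x y -> vle y x -> x = y.
Proof.
by case: x y => [a|] [b|] //= ab ba; congr Some; apply/le_anti; rewrite ab.
Qed.

Lemma vadd0 x : vadd (Some 0) x = x.
Proof. by case: x => [g|] //=; rewrite add0r. Qed.

Lemma vadd_le x x' y y' : vle x x' -> vle y y' -> vle (vadd x y) (vadd x' y').
Proof.
case: x x' y y' => [a|] [a'|] [b|] [b'|] //= aa bb.
apply: (@le_trans _ _ (a' + b)); first exact: ogroup_leD2r.
by rewrite ![a' + _]addrC; apply: ogroup_leD2r.
Qed.

Lemma vadd_ge0 x y : vle (Some 0) x -> vle (Some 0) y -> vle (Some 0) (vadd x y).
Proof. by move=> x0 y0; have := vadd_le x0 y0; rewrite /= addr0. Qed.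

Lemma vadd_gt0 x y : vlt (Some 0) x -> vle (Some 0) y -> vlt (Some 0) (vadd x y).
Proof.
move=> x0 y0; apply: (vlt_le_trans x0).
by have := vadd_le (vlexx x) y0; case: (x) => [g|] //=; rewrite addr0.
Qed.

Lemma vle_vmin z x y : vle z x -> vle z y -> vle z (vmin x y).
Proof. by rewrite /vmin; case: ifP. Qed.

Lemma vlt_vmin z x y : vlt z x -> vlt z y -> vlt z (vmin x y).
Proof. by rewrite /vmin; case: ifP. Qed.

End WithInfinity.

Record valuation (K : fieldType) := Valuation {
  vgroup : orderedGroup;
  vmap :> K -> option vgroup;
  vmap_eq_infty : forall a, vmap a = None <-> a = 0;
  vmapM : forall a b, vmap (a * b) = vadd (vmap a) (vmap b);
  vmapD : forall a b, vle (vmin (vmap a) (vmap b)) (vmap (a + b));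
  vmap_surj : forall g, exists a, vmap a = Some g
}.

Arguments vgroup {K} w : rename.

(** R_w and I_w, as predicates and as sets *)
Definition vring (K : fieldType) (w : valuation K) : {pred K} :=
  fun a => vle (Some 0) (w a).
Definition videal (K : fieldType) (w : valuation K) : {pred K} :=
  fun a => vlt (Some 0) (w a).
Definition vringset (K : fieldType) (w : valuation K) : set K :=
  [set a | a \in vring w].
Definition videalset (K : fieldType) (w : valuation K) : set K :=
  [set a | a \in videal w].

Section ValuationTheory.
Variables (K : fieldType) (w : valuation K).
Implicit Types a b : K.

Lemma in_vring a : (a \in vring w) = vle (Some 0) (w a). Proof. by []. Qed.
Lemma in_videal a : (a \in videal w) = vlt (Some 0) (w a). Proof. by []. Qed.

Lemma vmap0 : w 0 = None.
Proof. exact/(vmap_eq_infty w). Qed.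

Lemma vmap_neq0 a : a != 0 -> exists g, w a = Some g.
Proof.
case E: (w a) => [g|]; first by exists g.
by move/(vmap_eq_infty w): E => ->; rewrite eqxx.
Qed.

Lemma vmap1 : w 1 = Some 0.
Proof.
have [g wg] := vmap_neq0 (oner_neq0 K).
have := vmapM w 1 1; rewrite mulr1 wg /= => -[/eqP].
by rewrite -subr_eq0 opprD addrA subrr sub0r oppr_eq0 => /eqP ->.
Qed.

Lemma vmapN1 : w (-1) = Some 0.
Proof.
have N1 : (-1 : K) != 0 by rewrite oppr_eq0 oner_eq0.
have [g wg] := vmap_neq0 N1.
have := vmapM w (-1) (-1); rewrite mulrNN mulr1 vmap1 wg => -[/eqP gg].
congr Some; apply/le_anti; case/orP: (ogroup_total g 0) => g0; rewrite g0 ?andbT /=.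
  by have := ogroup_leD2r g g0; rewrite -(eqP gg) add0r.
by have := ogroup_leD2r g g0; rewrite -(eqP gg) add0r.
Qed.

Lemma vmapN a : w (- a) = w a.
Proof. by rewrite -mulN1r vmapM vmapN1 vadd0. Qed.

Lemma vmapV a : a != 0 -> vadd (w a^-1) (w a) = Some 0.
Proof. by move=> a0; rewrite -vmapM mulVf // vmap1. Qed.

Lemma vring_subring : subring_closed (vring w).
Proof.
split=> [|a b|a b]; first by rewrite in_vring vmap1 /=.
  rewrite !in_vring => a0 b0; apply: vle_trans (vmapD w a (- b)).
  by apply: vle_vmin => //; rewrite vmapN.
by rewrite !in_vring => a0 b0; rewrite vmapM vadd_ge0.
Qed.

Lemma vringV a : a \in vring w -> a \notin videal w -> a^-1 \in vring w.
Proof.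
rewrite !in_vring in_videal /vlt negbK => a0 a0'.
have wa : w a = Some 0 by apply: vle_anti.
have aN0 : a != 0 by apply/eqP => /(vmap_eq_infty w); rewrite wa.
have := vmapV aN0; rewrite wa.
by case: (w a^-1) => [g|] //=; rewrite addr0 => -[->].
Qed.

Lemma videal_vring a : a \in videal w -> a \in vring w.
Proof. exact: vltW. Qed.

HB.instance Definition _ :=
  GRing.isSubringClosed.Build K (vring w) vring_subring.

Definition vRing := {a : K | a \in vring w}.
HB.instance Definition _ := [isSub of vRing for sval].
HB.instance Definition _ := [Choice of vRing by <:].
HB.instance Definition _ := [SubChoice_isSubComNzRing of vRing by <:].

Definition vmaxideal : {pred vRing} := fun a : vRing => val a \in videal w.

Lemma in_vmaxideal (x : vRing) :
  (x \in vmaxideal) = vlt (Some 0) (w (val x)).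
Proof. by []. Qed.

Lemma vmaxideal_idealr : idealr_closed vmaxideal.
Proof.
split; first by rewrite in_vmaxideal rmorph0 vmap0.
  by rewrite in_vmaxideal rmorph1 vmap1 /vlt /= lexx.
move=> a x y; rewrite !in_vmaxideal rmorphD rmorphM => x0 y0.
apply: vlt_le_trans (vmapD w _ _); apply: vlt_vmin => //.
rewrite mulrC vmapM; apply: vadd_gt0 => //; exact: (valP a).
Qed.

HB.instance Definition _ := isIdealr.Build vRing vmaxideal vmaxideal_idealr.

(** Kw = R_w / I_w *)
Definition residue_field := {ideal_quot vmaxideal}.
HB.instance Definition _ := GRing.ComNzRing.on residue_field.
HB.instance Definition _ := Quotient.on residue_field.

Definition rpi (x : vRing) : residue_field := \pi_{ideal_quot vmaxideal} x.

Lemma rpi_eq x y : (rpi x == rpi y) = (x - y \in vmaxideal).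
Proof. by rewrite Quotient.idealrBE. Qed.

Lemma rpiB x y : rpi (x - y) = rpi x - rpi y.
Proof. by rewrite /rpi rmorphB. Qed.
Lemma rpiD x y : rpi (x + y) = rpi x + rpi y.
Proof. by rewrite /rpi rmorphD. Qed.
Lemma rpiM x y : rpi (x * y) = rpi x * rpi y.
Proof. by rewrite /rpi rmorphM. Qed.
Lemma rpi0 : rpi 0 = 0.
Proof. by rewrite /rpi rmorph0. Qed.
Lemma rpi1 : rpi 1 = 1.
Proof. by rewrite /rpi rmorph1. Qed.
Lemma rpiK (x : residue_field) : rpi (repr x) = x.
Proof. exact: reprK. Qed.

(** The residue map of w, extended by 0 outside R_w *)
Definition res (a : K) : residue_field :=
  if insub a is Some x then rpi x else 0.

Definition residue_inv (x : residue_field) : residue_field :=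
  res (val (repr x))^-1.

Lemma residue_mulVf x : x != 0 -> residue_inv x * x = 1.
Proof.
rewrite -{1 3}[x]rpiK -{1}rpi0 rpi_eq subr0 in_vmaxideal => xI.
have xV := vringV (valP (repr x)) xI.
rewrite /residue_inv /res insubT -rpiM -rpi1; congr rpi; apply/val_inj.
rewrite rmorphM rmorph1 /= mulVf //; apply/eqP=> x0.
by move: xI; rewrite /= x0 vmap0.
Qed.

Lemma residue_inv0 : residue_inv 0 = 0.
Proof.
have: (repr (0 : residue_field)) \in vmaxideal.
  by rewrite -[repr _]subr0 -rpi_eq rpiK rpi0.
rewrite in_vmaxideal /residue_inv /res; move: (val _) => a a0.
case: insubP => // x; rewrite in_vring => aV xa.
have [az|an0] := eqVneq a 0.
  by apply/eqP; rewrite -rpi0 rpi_eq subr0 in_vmaxideal xa az invr0 vmap0.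
have := vadd_gt0 a0 aV; rewrite -vmapM mulfV // vmap1.
by rewrite /vlt /= lexx.
Qed.

HB.instance Definition _ :=
  GRing.ComNzRing_isField.Build residue_field residue_mulVf residue_inv0.

End ValuationTheory.

Arguments vmaxideal {K} w _ : rename.
Arguments res {K} w a : rename.

Definition convex_in (K : realFieldType) (S : set K) :=
  forall a b c, S a -> S b -> a <= c <= b -> S c.

Record convex_valuation (K : realFieldType) := ConvexValuation {
  cvaluation :> valuation K;
  cvaluation_convex : convex_in (vringset cvaluation)
}.

Section ConvexValuation.
Variables (K : realFieldType) (w : convex_valuation K).
Local Notation Kw := (residue_field w).
Local Notation Rw := (vRing w).
Implicit Types (a b c : K) (x y : Kw) (r s : Rw).

Lemma vring_convex a b c :
  a \in vring w -> b \in vring w -> a <= c <= b -> c \in vring w.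
Proof. exact: (@cvaluation_convex _ w). Qed.

Lemma videal_convex a b : b \in videal w -> 0 < a <= b -> a \in videal w.
Proof.
move=> bI /andP[a0 ab]; have b0 := lt_le_trans a0 ab.
have aR : a \in vring w.
  by apply: (vring_convex (rpred0 _) (videal_vring bI)); rewrite (ltW a0).
case: (boolP (a \in videal w)) => // aNI.
have aV := vringV aR aNI.
have abR : a / b \in vring w.
  apply: (vring_convex (rpred0 _) (rpred1 _)).
  by rewrite divr_ge0 ?(ltW a0) ?(ltW b0) //= ler_pdivrMr // mul1r.
have baR : a^-1 * (a / b) \in vring w by rewrite rpredM.
rewrite mulKf ?gt_eqF // in baR.
have := vadd_gt0 bI baR.
by rewrite -vmapM mulfV ?gt_eqF // vmap1 /vlt /= lexx.
Qed.

(* The order induced on Kw: x <= y when a <= b for representatives a of x and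
   b of y; for x != y the choice of a and b is irrelevant (see [rle_rpi]). *)
Definition rle x y : bool := val (repr x) <= val (repr y).
Definition rlt x y : bool := (y != x) && rle x y.
Definition rnorm x : Kw := if rle 0 x then x else - x.

Lemma rpi_lt_repr r s : rpi r != rpi s -> val r < val s ->
  rle (rpi r) (rpi s).
Proof.
move=> rs_neq rs; rewrite /rle leNgt; apply/negP => sr.
case/negP: rs_neq; rewrite eq_sym rpi_eq.
set r' := repr (rpi r) in sr *; set s' := repr (rpi s) in sr *.
have rI : r' - r \in vmaxideal w by rewrite -rpi_eq /r' rpiK.
have sI : s' - s \in vmaxideal w by rewrite -rpi_eq /s' rpiK.
have dI : (r' - r) - (s' - s) \in vmaxideal w by rewrite rpredB.
apply: (videal_convex dI); rewrite !rmorphB /= subr_gt0 rs /=.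
rewrite -subr_ge0.
suff -> : val r' - val r - (val s' - val s) - (val s - val r) =
  val r' - val s' by rewrite subr_ge0 ltW.
ring.
Qed.

Lemma rle_anti x y : rle x y -> rle y x -> x = y.
Proof.
move=> xy yx; rewrite -[x]rpiK -[y]rpiK; congr rpi; apply/val_inj/le_anti.
by rewrite -/(rle x y) xy.
Qed.

Lemma rle_total x y : rle x y || rle y x.
Proof. exact: le_total. Qed.

Lemma rle_refl x : rle x x.
Proof. exact: lexx. Qed.

Lemma rle_rpi r s : rpi r != rpi s -> rle (rpi r) (rpi s) = (val r <= val s).
Proof.
move=> rs; apply/idP/idP => [le|]; last first.
  rewrite le_eqVlt => /orP[/eqP/val_inj e|]; last exact: rpi_lt_repr.
  by rewrite e eqxx in rs.
rewrite leNgt; apply/negP => sr.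
have /(rle_anti le)/eqP : rle (rpi s) (rpi r).
  by apply: rpi_lt_repr; rewrite // eq_sym.
exact/negP.
Qed.

Lemma le_rpi r s : val r <= val s -> rle (rpi r) (rpi s).
Proof.
move=> rs; have [->|ne] := eqVneq (rpi r) (rpi s); first exact: rle_refl.
by rewrite rle_rpi.
Qed.

Lemma rleB x y : rle 0 (y - x) = rle x y.
Proof.
rewrite -[x]rpiK -[y]rpiK -rpiB -rpi0.
have [e|ne] := eqVneq (rpi (repr x)) (rpi (repr y)).
  by rewrite rpiB e subrr rpi0 !rle_refl.
rewrite !rle_rpi ?rmorphB ?rmorph0 ?subr_ge0 //.
by rewrite rpi0 rpiB eq_sym subr_eq0 eq_sym.
Qed.

Lemma rle0_repr x : rle 0 x -> exists2 r, x = rpi r & 0 <= val r.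
Proof.
have [->|x0] := eqVneq x 0; first by exists 0; rewrite ?rpi0 ?rmorph0.
rewrite -{1 2}[x]rpiK -rpi0 => le; exists (repr x); first by rewrite rpiK.
by rewrite -(rmorph0 (val : Rw -> K)) -rle_rpi // rpiK rpi0 eq_sym.
Qed.

Lemma rle0_add x y : rle 0 x -> rle 0 y -> rle 0 (x + y).
Proof.
move=> /rle0_repr[r -> r0] /rle0_repr[s -> s0].
by rewrite -rpiD -rpi0; apply: le_rpi; rewrite rmorph0 rmorphD addr_ge0.
Qed.

Lemma rle0_mul x y : rle 0 x -> rle 0 y -> rle 0 (x * y).
Proof.
move=> /rle0_repr[r -> r0] /rle0_repr[s -> s0].
by rewrite -rpiM -rpi0; apply: le_rpi; rewrite rmorph0 rmorphM mulr_ge0.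
Qed.

Lemma rle0N x : rle 0 (- x) = rle x 0.
Proof. by rewrite -(rleB x 0) sub0r. Qed.

Lemma rle0_anti x : rle 0 x -> rle x 0 -> x = 0.
Proof. by move=> x0 x0'; apply: rle_anti. Qed.

Lemma rnormN x : rnorm (- x) = rnorm x.
Proof.
rewrite /rnorm rle0N opprK.
case: ifP => x0; case: ifP => x0' //.
  by rewrite (rle0_anti x0' x0) oppr0.
by have := rle_total 0 x; rewrite x0 x0'.
Qed.

Lemma rge0_norm x : rle 0 x -> rnorm x = x.
Proof. by rewrite /rnorm => ->. Qed.

HB.instance Definition _ :=
  Num.IntegralDomain_isLeReal.Build Kw
    rle0_add rle0_mul rle0_anti rleB (rle_total 0) rnormN rge0_norm
    (fun _ _ => erefl).

Lemma le_res a b :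
  a \in vring w -> b \in vring w -> a <= b -> res w a <= res w b.
Proof. by move=> aR bR ab; rewrite /res !insubT; apply: le_rpi. Qed.

End ConvexValuation.

(** The archimedean classes of nonzero elements form the value group vK, with
    [a] + [b] = [ab] and [a] <= [b] iff |b| <= n|a| for some n. *)
Section ArchimedeanClasses.
Variable K : realFieldType.

Definition nonzero := {a : K | a != 0}.
HB.instance Definition _ := [isSub of nonzero for sval].
HB.instance Definition _ := [Choice of nonzero by <:].
Implicit Types a b c d : nonzero.

Definition nz1 : nonzero := Sub 1 (oner_neq0 K).

Fact nz_mul_subproof a b : val a * val b != 0.
Proof. by rewrite mulf_neq0 ?(valP a) ?(valP b). Qed.
Definition nz_mul a b : nonzero := Sub (val a * val b) (nz_mul_subproof a b).

Fact nz_inv_subproof a : (val a)^-1 != 0.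
Proof. by rewrite invr_neq0 ?(valP a). Qed.
Definition nz_inv a : nonzero := Sub (val a)^-1 (nz_inv_subproof a).

Definition arch_le a b : bool := `[< exists n, `|val b| <= n%:R * `|val a| >].
Definition arch_equiv a b : bool := arch_le a b && arch_le b a.

Lemma arch_leP a b :
  reflect (exists n, `|val b| <= n%:R * `|val a|) (arch_le a b).
Proof. exact: asboolP. Qed.

Lemma arch_le_refl a : arch_le a a.
Proof. by apply/arch_leP; exists 1; rewrite mul1r. Qed.

Lemma arch_le_trans b a c : arch_le a b -> arch_le b c -> arch_le a c.
Proof.
move=> /arch_leP[m ab] /arch_leP[n bc]; apply/arch_leP; exists (n * m)%N.
by rewrite natrM -mulrA; apply: le_trans bc _; rewrite ler_wpM2l.
Qed.

Lemma arch_le_total a b : arch_le a b || arch_le b a.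
Proof.
case: (leP `|val a| `|val b|) => [ab|/ltW ba]; apply/orP; [right|left];
  by apply/arch_leP; exists 1; rewrite mul1r.
Qed.

Lemma arch_le_mul a b c d :
  arch_le a b -> arch_le c d -> arch_le (nz_mul a c) (nz_mul b d).
Proof.
move=> /arch_leP[m ab] /arch_leP[n cd]; apply/arch_leP; exists (m * n)%N.
by rewrite /= !normrM natrM mulrACA ler_pM.
Qed.

Lemma arch_equiv_is_equiv : equiv_class_of arch_equiv.
Proof.
split=> [a|a b|b a c]; rewrite /arch_equiv ?arch_le_refl //.
  by rewrite andbC.
move=> /andP[ab ba] /andP[bc cb].
by rewrite (arch_le_trans ab bc) (arch_le_trans cb ba).
Qed.

Canonical arch_equiv_equiv := EquivRelPack arch_equiv_is_equiv.
Canonical arch_equiv_encModRel := defaultEncModRel arch_equiv.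

Definition arch_class := {eq_quot arch_equiv}.
HB.instance Definition _ := Choice.on arch_class.
HB.instance Definition _ := EqQuotient.on arch_class.

Definition cls a : arch_class := \pi_arch_class a.
Implicit Types x y z : arch_class.

Lemma cls_eq a b : (cls a == cls b) = arch_equiv a b.
Proof. by rewrite /cls piE. Qed.

Lemma clsK x : cls (repr x) = x.
Proof. exact: reprK. Qed.

Lemma cls_ind (P : arch_class -> Prop) : (forall a, P (cls a)) -> forall x, P x.
Proof. by move=> Pcls x; rewrite -[x]clsK. Qed.

Lemma repr_cls a : arch_le (repr (cls a)) a /\ arch_le a (repr (cls a)).
Proof. by apply/andP; rewrite -/(arch_equiv _ _) -cls_eq clsK. Qed.

Definition cls_le x y : bool := arch_le (repr x) (repr y).
Definition cls_lt x y : bool := (y != x) && cls_le x y.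
Definition cls_zero : arch_class := cls nz1.
Definition cls_add x y : arch_class := cls (nz_mul (repr x) (repr y)).
Definition cls_opp x : arch_class := cls (nz_inv (repr x)).

Lemma cls_leE a b : cls_le (cls a) (cls b) = arch_le a b.
Proof.
have [[a1 a2] [b1 b2]] := (repr_cls a, repr_cls b); apply/idP/idP => ab.
  exact: arch_le_trans (arch_le_trans a2 ab) b1.
exact: arch_le_trans (arch_le_trans a1 ab) b2.
Qed.

Lemma cls_addE a b : cls_add (cls a) (cls b) = cls (nz_mul a b).
Proof.
have [[a1 a2] [b1 b2]] := (repr_cls a, repr_cls b); apply/eqP.
by rewrite cls_eq /arch_equiv !arch_le_mul.
Qed.

Lemma cls_addA : associative cls_add.
Proof.
elim/cls_ind=> a; elim/cls_ind=> b; elim/cls_ind=> c; rewrite !cls_addE.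
by congr cls; apply/val_inj; rewrite /= mulrA.
Qed.

Lemma cls_addC : commutative cls_add.
Proof.
elim/cls_ind=> a; elim/cls_ind=> b; rewrite !cls_addE.
by congr cls; apply/val_inj; rewrite /= mulrC.
Qed.

Lemma cls_add0 : left_id cls_zero cls_add.
Proof.
elim/cls_ind=> a; rewrite cls_addE.
by congr cls; apply/val_inj; rewrite /= mul1r.
Qed.

Lemma cls_addN : left_inverse cls_zero cls_opp cls_add.
Proof.
move=> x; rewrite -{2}[x]clsK /cls_opp cls_addE.
by congr cls; apply/val_inj; rewrite /= mulVf ?(valP (repr x)).
Qed.

HB.instance Definition _ :=
  GRing.isZmodule.Build arch_class cls_addA cls_addC cls_add0 cls_addN.

Lemma cls_le_refl : reflexive cls_le.
Proof. by move=> x; apply: arch_le_refl. Qed.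

Lemma cls_le_anti : antisymmetric cls_le.
Proof.
by move=> x y xy; apply/eqP; rewrite -[x]clsK -[y]clsK cls_eq.
Qed.

Lemma cls_le_trans : transitive cls_le.
Proof. by move=> y x z; apply: arch_le_trans. Qed.

HB.instance Definition _ :=
  Order.isPOrder.Build ring_display arch_class (fun _ _ => erefl)
    cls_le_refl cls_le_anti cls_le_trans.

Lemma cls_le_total : total (<=%R : rel arch_class).
Proof. by move=> x y; apply: arch_le_total. Qed.

Lemma cls_leD2r x y z : x <= y -> x + z <= y + z.
Proof.
elim/cls_ind: x => a; elim/cls_ind: y => b; elim/cls_ind: z => c.
rewrite /Order.le /GRing.add /= !cls_addE !cls_leE => ab.
by rewrite arch_le_mul ?arch_le_refl.
Qed.

Definition arch_group : orderedGroup := OrderedGroup cls_le_total cls_leD2r.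

Definition natmap (a : K) : option arch_group :=
  omap cls (insub a).

Lemma natmap0 : natmap 0 = None.
Proof. by rewrite /natmap insubN // eqxx. Qed.

Lemma natmapE (a : nonzero) : natmap (val a) = Some (cls a).
Proof. by rewrite /natmap valK. Qed.

Lemma nonzeroP (a : K) : a = 0 \/ exists b : nonzero, a = val b.
Proof.
by have [->|a0] := eqVneq a 0; [left|right; exists (Sub a a0)].
Qed.

Lemma natmap_le (a b : K) :
  vle (natmap a) (natmap b) <-> exists n, `|b| <= n%:R * `|a|.
Proof.
case: (nonzeroP b) => [->|[b' ->]].
  rewrite natmap0; case: (natmap a) => [g|] /=; split=> // _; exists 0%N;
  by rewrite normr0 mul0r.
case: (nonzeroP a) => [->|[a' ->]]; rewrite ?natmap0 natmapE.
  split=> // -[n]; rewrite normr0 mulr0 normr_le0.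
  by rewrite (negbTE (valP b')).
rewrite natmapE /= /Order.le /= cls_leE; split; first exact/arch_leP.
by move=> ?; apply/arch_leP.
Qed.

Lemma natmap_eq_infty (a : K) : natmap a = None <-> a = 0.
Proof.
split=> [|->]; last exact: natmap0.
by case: (nonzeroP a) => [->|[b ->]] //; rewrite natmapE.
Qed.

Lemma natmapM (a b : K) : natmap (a * b) = vadd (natmap a) (natmap b).
Proof.
case: (nonzeroP a) => [->|[a' ->]]; first by rewrite mul0r natmap0.
case: (nonzeroP b) => [->|[b' ->]].
  by rewrite mulr0 natmap0 natmapE.
rewrite !natmapE /=; have -> : cls a' + cls b' = cls (nz_mul a' b') by exact: cls_addE.
exact: natmapE (nz_mul a' b').
Qed.

Lemma natmapD (a b : K) : vle (vmin (natmap a) (natmap b)) (natmap (a + b)).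
Proof.
suff H (c d : K) : vle (natmap c) (natmap d) -> vle (natmap c) (natmap (c + d)).
  rewrite /vmin; case: ifP => [|ab]; first exact: H.
  by rewrite addrC H //; case/orP: (vle_total (natmap a) (natmap b)); rewrite ?ab.
move=> /natmap_le[n dc]; apply/natmap_le; exists n.+1.
by rewrite [c + d]addrC -natr1 mulrDl mul1r (le_trans (ler_normD _ _)) ?lerD2r.
Qed.

Lemma natmap_surj g : exists a : K, natmap a = Some g.
Proof. by elim/cls_ind: g => a; exists (val a); rewrite natmapE. Qed.

Definition natval : valuation K :=
  Valuation natmap_eq_infty natmapM natmapD natmap_surj.

Lemma natval_lt (a b : K) :
  vlt (natval a) (natval b) <-> forall n, n%:R * `|b| < `|a|.
Proof.
rewrite /vlt; split.
  by move=> /negP ba n; rewrite ltNge; apply/negP => le; apply/ba/natmap_le; exists n.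
by move=> H; apply/negP => /natmap_le[n]; rewrite leNgt H.
Qed.

End ArchimedeanClasses.

Arguments natval : clear implicits.

Definition cofinal (F : realFieldType) (s : nat -> F) :=
  forall x, exists n, x <= s n.

Section Rank.
Variable K : realFieldType.
Local Notation v := (natval K).
Local Notation vK := (vgroup v).
Implicit Types (w : valuation K) (f : K -> K) (H : set vK).

Definition positive_infinite (a : K) := 0 < a /\ a \notin vring v.

Definition pos_units w : set K := [set a | w a = Some 0 /\ 0 < a].

(** G_w, a subset of vK (not of wK) *)
Definition vsubgroup w : set vK :=
  [set g | exists a, w a = Some 0 /\ v a = Some g].

Definition convex_subgroup H :=
  [/\ H 0, (forall g h, H g -> H h -> H (g - h))
    & forall g h k, H g -> H h -> g <= k <= h -> H k].

Definition is_smallest (P : set (set vK)) H :=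
  P H /\ forall H', P H' -> H `<=` H'.

Definition principal H :=
  exists g, is_smallest [set H' | convex_subgroup H' /\ H' g] H.

Definition exp_closed f H :=
  forall a, (Some @` H) (v a) -> (Some @` H) (v (f a)).

Definition exp_principal f H := exists g,
  is_smallest [set H' | [/\ convex_subgroup H', H' g & exp_closed f H']] H.

(* Valuations with the same ring are identified, so w <> v is R_w <> R_v. *)
Definition proper_coarsening w :=
  vringset v `<=` vringset w /\ vringset w <> vringset v.

Definition rank : set (set K) :=
  [set R | exists w, R = vringset w /\ proper_coarsening w].

Definition principal_rank : set (set K) :=
  [set R | exists w, [/\ R = vringset w, rank R & principal (vsubgroup w)]].

Definition exponential f :=
  [/\ (forall a, 0 < f a), (forall b, 0 < b -> exists a, f a = b),
      {morph f : a b / a + b >-> a * b} & {mono f : a b / a < b}].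

Definition compatible w f :=
  f @` vringset w = pos_units w /\
  f @` videalset w = [set 1 + a | a in videalset w].

Definition T1_exponential f :=
  [/\ exponential f, compatible v f &
      forall a, a \in videal v -> a != 0 -> vlt (v a) (v (f a - 1 - a))].

Definition strong f := forall (n : nat) (a : K), n%:R ^+ 2 < a -> a ^+ n < f a.

Definition exp_rank f : set (set K) :=
  [set R | exists w, [/\ R = vringset w, rank R & f @` R = pos_units w]].

Definition principal_exp_rank f : set (set K) :=
  [set R | exists w,
    [/\ R = vringset w, exp_rank f R & exp_principal f (vsubgroup w)]].

(* fw sends the residue of a to that of f a; when w and f are compatible this
   does not depend on the representative (see [induced_expE]). *)
Definition induced_exp w f (x : residue_field w) : residue_field w :=
  res w (f (val (repr x))).

Lemma induced_expE w f a : exponential f -> compatible w f ->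
  a \in vring w -> induced_exp f (res w a) = res w (f a).
Proof.
move=> [f_gt0 _ fD _] [fR fI] aR.
have fRR b : b \in vring w -> f b \in vring w.
  move=> bR; have : (f @` vringset w) (f b) by exists b.
  by rewrite fR => -[fb _]; rewrite in_vring fb vlexx.
have -> : res w a = rpi (Sub a aR) by rewrite /res insubT.
rewrite /induced_exp; set r := repr _.
have rI : val r - a \in videal w.
  have : r - Sub a aR \in vmaxideal w by rewrite -rpi_eq rpiK.
  by rewrite in_vmaxideal rmorphB.
have [e eI fe] : [set 1 + e | e in videalset w] (f (val r - a)).
  by rewrite -fI; exists (val r - a).
rewrite /res !insubT ?fRR ?(valP r) // => faR frR.
apply/eqP; rewrite rpi_eq in_vmaxideal rmorphB /=.
rewrite -[X in f X](subrK a) fD -fe mulrDl mul1r addrAC subrr add0r vmapM.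
by apply: vadd_gt0 => //; apply: fRR.
Qed.

End Rank.

Arguments induced_exp {K} w f x.
Arguments rank : clear implicits.
Arguments principal_rank : clear implicits.

(* Main.v *)
(* A convex subring S of K determines the convex subgroup U_S of vK formed by
   the values of the units of S, and every convex subring is the valuation ring
   of the quotient of v by U_S; so the rank consists of the convex subrings
   other than R_v. For a large enough, the elements bounded by a member of the
   sequence a^n (resp. f^n(a)) form a convex subring, the hull of a, and if S is
   stable (no condition, resp. f(S) is the set of positive units of S), then U_S
   is (f-)principal iff S is the hull of some a in S: a generator g = va gives
   U_S inside the classes of the hull, and conversely a (f-closed) convex
   subgroup containing va contains the values of the whole sequence. Being the
   hull of a means, read in Kw, that the sequence of res a is cofinal. If there is
   just one (f-)principal ring R, it is the hull of every positive infinite a,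
   whence R contains all of K. *)
Require Import Defs.
From HB Require Import structures.
From mathcomp Require Import all_boot all_order all_algebra.
From mathcomp Require Import ring_quotient generic_quotient.
From mathcomp Require Import boolp classical_sets.

Set Implicit Arguments.
Unset Strict Implicit.
Unset Printing Implicit Defensive.

Import Order.TTheory GRing.Theory Num.Theory.

Local Open Scope ring_scope.
Local Open Scope quotient_scope.
Local Open Scope classical_set_scope.

(** * Quotient of a valuation by a convex subgroup of its value group *)

Section GroupQuotient.
Variables (K : fieldType) (v : valuation K) (H : zmodClosed (vgroup v)).
Local Notation G := (vgroup v).
Hypothesis H_convex : forall g k, g \in H -> 0 <= k <= g -> k \in H.
Implicit Types (g h k : G).

(** The quotient of the value group by [H]. Convexity is a parameter of the type so that the order
    on the quotient, which depends on it, can be attached as a canonical instance. *)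
Definition coarse_group (_ : forall g k, g \in H -> 0 <= k <= g -> k \in H) :=
  Quotient.quot H.
Local Notation GH := (coarse_group H_convex).
HB.instance Definition _ := GRing.Zmodule.on GH.
HB.instance Definition _ := Quotient.on GH.
Implicit Types (x y z : GH).

Definition coarse_map g : GH := \pi_(Quotient.quot H) g.

Lemma coarse_mapD g h : coarse_map (g + h) = coarse_map g + coarse_map h.
Proof. by rewrite /coarse_map raddfD. Qed.

Lemma coarse_map_eq g h : (coarse_map g == coarse_map h) = (g - h \in H).
Proof. by rewrite Quotient.idealrBE. Qed.

Lemma coarse_mapK x : coarse_map (repr x) = x.
Proof. exact: reprK. Qed.

Definition coarse_le x y : bool := `[< exists2 h, h \in H & repr x <= repr y + h >].

(** Makes [coarse_le] independent of representatives: replacing one by another shifts each side by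
    an element of [H], and the witness [k] absorbs both shifts. *)
Lemma coarse_leE g h :
  coarse_le (coarse_map g) (coarse_map h) <-> exists2 k, k \in H & g <= h + k.
Proof.
have shift a b p q : p \in H -> q \in H ->
    (exists2 k, k \in H & a <= b + k) -> exists2 k, k \in H & a + p <= b + q + k.
  move=> pH qH [k kH ab]; exists (k + p - q); first by rewrite rpredB ?rpredD.
  by rewrite addrACA subrr addr0 addrA; apply: ogroup_leD2r.
have reprE u : exists2 p, p \in H & repr (coarse_map u) = u + p.
  exists (repr (coarse_map u) - u); last by rewrite addrC subrK.
  by rewrite -coarse_map_eq coarse_mapK.
have [[p pH gp] [q qH hq]] := (reprE g, reprE h); rewrite /coarse_le gp hq.
split=> [/asboolP le|le]; last by apply/asboolP; apply: shift.
by rewrite -[g](addrK p) -[h](addrK q); apply: shift le; rewrite rpredN.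
Qed.

Lemma coarse_le_refl : reflexive coarse_le.
Proof. by move=> x; apply/asboolP; exists 0; rewrite ?rpred0 ?addr0. Qed.

Lemma ogroup_leBlDl g h k : (g - h <= k) = (g <= h + k).
Proof.
apply/idP/idP => gh; first by have := ogroup_leD2r h gh; rewrite subrK addrC.
by have := ogroup_leD2r (- h) gh; rewrite addrAC subrr add0r.
Qed.

Lemma coarse_le_anti : antisymmetric coarse_le.
Proof.
move=> x y; rewrite -[x]coarse_mapK -[y]coarse_mapK.
move: (repr x) (repr y) => {x y} g h /andP[/coarse_leE[k kH gh] /coarse_leE[l lH hg]].
apply/eqP; rewrite coarse_map_eq.
(* The two inequalities put [g - h] between [- l] and [k]. Translating by [l] makes the lower end 0,
   the form in which convexity of [H] is available. *)
suff : g - h + l \in H by move=> H1; rewrite -[g - h](addrK l) rpredB.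
apply: (H_convex (rpredD kH lH)); apply/andP; split.
  have := ogroup_leD2r (- h) hg; rewrite subrr.
  by rewrite addrAC.
by apply: ogroup_leD2r; rewrite ogroup_leBlDl.
Qed.

Lemma coarse_le_trans : transitive coarse_le.
Proof.
move=> y x z; rewrite -[x]coarse_mapK -[y]coarse_mapK -[z]coarse_mapK.
move: (repr x) (repr y) (repr z) => g h i /coarse_leE[k kH gh] /coarse_leE[l lH hi].
apply/coarse_leE; exists (l + k); rewrite ?rpredD // addrA.
by apply: le_trans gh (ogroup_leD2r _ hi).
Qed.

HB.instance Definition _ :=
  Order.isPOrder.Build ring_display GH (fun _ _ => erefl)
    coarse_le_refl coarse_le_anti coarse_le_trans.

Lemma coarse_map_le g h : g <= h -> coarse_map g <= coarse_map h.
Proof. by move=> gh; apply/coarse_leE; exists 0; rewrite ?rpred0 ?addr0. Qed.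

Lemma coarse_le_total : total (<=%R : rel GH).
Proof.
move=> x y; rewrite -[x]coarse_mapK -[y]coarse_mapK.
by case/orP: (ogroup_total (repr x) (repr y)) => /coarse_map_le ->; rewrite ?orbT.
Qed.

Lemma coarse_leD2r x y z : x <= y -> x + z <= y + z.
Proof.
rewrite -[x]coarse_mapK -[y]coarse_mapK -[z]coarse_mapK -!coarse_mapD.
move=> /coarse_leE[k kH xy]; apply/coarse_leE; exists k => //.
by rewrite addrAC; apply: ogroup_leD2r.
Qed.

Definition coarse_ogroup : orderedGroup := OrderedGroup coarse_le_total coarse_leD2r.

Definition coarsening (a : K) : option coarse_ogroup := omap coarse_map (v a).

Lemma coarsening_le a b : vle (v a) (v b) -> vle (coarsening a) (coarsening b).
Proof.
by rewrite /coarsening; case: (v a) (v b) => [g|] [h|] //=; apply: coarse_map_le.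
Qed.

Lemma coarsening_eq_infty a : coarsening a = None <-> a = 0.
Proof. by rewrite -(vmap_eq_infty v) /coarsening; case: (v a). Qed.

Lemma coarseningM a b : coarsening (a * b) = vadd (coarsening a) (coarsening b).
Proof.
rewrite /coarsening vmapM; case: (v a) (v b) => [g|] [h|] //=.
by rewrite coarse_mapD.
Qed.

Lemma coarseningD a b : vle (vmin (coarsening a) (coarsening b)) (coarsening (a + b)).
Proof.
have vmin_le (x y : option coarse_ogroup) : vle (vmin x y) x && vle (vmin x y) y.
  rewrite /vmin; case: ifP => xy; rewrite ?vlexx ?xy //= andbT.
  by case/orP: (vle_total x y); rewrite ?xy.
have /andP[mina minb] := vmin_le (coarsening a) (coarsening b).
have := vmapD v a b; rewrite /vmin; case: ifP => _ /coarsening_le; exact: vle_trans.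
Qed.

Lemma coarsening_surj x : exists a, coarsening a = Some x.
Proof.
have [a va] := vmap_surj (repr x); exists a.
by rewrite /coarsening va /= coarse_mapK.
Qed.

Definition coarse_valuation : valuation K :=
  Valuation coarsening_eq_infty coarseningM coarseningD coarsening_surj.

Lemma coarse_vringP a :
  a \in vring coarse_valuation <-> exists2 k, k \in H & vle (Some (- k)) (v a).
Proof.
rewrite in_vring /= /coarsening; case: (v a) => [g|] /=; last first.
  by split=> // _; exists 0; rewrite ?rpred0.
rewrite -[0 : coarse_group _](raddf0 (\pi_(Quotient.quot H))) -/(coarse_map 0).
split=> [/coarse_leE[k kH kg]|[k kH kg]]; [exists k|apply/coarse_leE; exists k] => //.
  by rewrite -[- k]add0r ogroup_leBlDl addrC.
by rewrite addrC -ogroup_leBlDl add0r.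
Qed.

End GroupQuotient.

(** * Convex subrings, their unit classes and the coarsenings of the natural valuation *)

Section ConvexSubrings.
Variable K : realFieldType.
Local Notation v := (natval K).
Implicit Types (a b c : K) (S : set K) (w : valuation K).

Definition convex_subring S :=
  [/\ S 1, (forall a b, S a -> S b -> S (a - b)),
      (forall a b, S a -> S b -> S (a * b))
    & forall a b, S b -> `|a| <= `|b| -> S a].

Section Closure.
Variables (S : set K) (HS : convex_subring S).

Lemma subring0 : S 0.
Proof. by case: HS => S1 SB _ _; rewrite -(subrr 1); apply: SB. Qed.

Lemma subringD a b : S a -> S b -> S (a + b).
Proof.
case: HS => _ SB _ _ Sa Sb; rewrite -[b]opprK; apply: (SB) => //.
by rewrite -sub0r; apply: SB => //; apply: subring0.
Qed.

Lemma subring_nat n : S n%:R.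
Proof.
by elim: n => [|n IH]; [exact: subring0|rewrite -natr1; apply: subringD; case: HS].
Qed.

Lemma subring_convex a b : `|a| <= b -> S b -> S a.
Proof.
by case: HS => _ _ _ Sc ab Sb; apply: Sc Sb _; rewrite (le_trans ab) // ler_norm.
Qed.

Lemma subring_norm a : S a -> S `|a|.
Proof. by case: HS => _ _ _ Sc Sa; apply: Sc Sa _; rewrite normr_id. Qed.

Lemma subring_inv a : 1 <= a -> S a^-1.
Proof.
move=> a1; apply: (@subring_convex _ 1); last by case: HS.
by rewrite normfV invf_le1 ger0_norm // ?(le_trans ler01) // (lt_le_trans ltr01).
Qed.

Lemma subring_scale n a b : `|a| <= n%:R * `|b| -> S b -> S a.
Proof.
move=> ab /subring_norm Sb; apply: (subring_convex ab).
by case: HS => _ _ SM _; apply: SM => //; apply: subring_nat.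
Qed.

Lemma subring_scaleV n a b : 0 < `|a| -> 0 < `|b| -> `|b| <= n%:R * `|a| ->
  S b^-1 -> S a^-1.
Proof.
move=> a0 b0 ba; apply: (@subring_scale n).
by rewrite !normfV -[_^-1]mul1r ler_pdivrMr // mulrAC ler_pdivlMr // mul1r.
Qed.

End Closure.

Lemma natval_le a b : vle (v a) (v b) <-> exists n, `|b| <= n%:R * `|a|.
Proof. exact: natmap_le. Qed.

Lemma natval_norm_gt0 a g : v a = Some g -> 0 < `|a|.
Proof.
by move=> va; rewrite normr_gt0; apply/eqP => a0; move: va; rewrite a0 vmap0.
Qed.

Lemma natval_vringP a : vringset v a <-> exists n, `|a| <= n%:R.
Proof.
rewrite /vringset /= in_vring -(vmap1 v).
rewrite natval_le; split=> -[n an]; exists n; move: an;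
  by rewrite normr1 mulr1.
Qed.

Lemma natval_sub S : convex_subring S -> vringset v `<=` S.
Proof.
move=> HS a /natval_vringP[n an].
by apply: (subring_convex HS an); apply: subring_nat.
Qed.

Definition unit_classes S : set (vgroup v) :=
  [set g | exists a, [/\ S a, S a^-1 & v a = Some g]].

(** Being a unit of [S] depends only on the archimedean class: elements of equal value bound each
    other up to natural factors, so do their inverses, and [S] is convex and contains the natural
    numbers. *)
Lemma unit_classesP S a g : convex_subring S -> v a = Some g ->
  unit_classes S g <-> S a /\ S a^-1.
Proof.
move=> HS va; split=> [[b [Sb SVb vb]]|[Sa SVa]]; last by exists a.
have [[n ab] [m ba]] : (exists n, `|a| <= n%:R * `|b|) /\
    exists m, `|b| <= m%:R * `|a|.
  by split; apply/natval_le; rewrite va vb vlexx.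
have a0 := natval_norm_gt0 va.
have b0 := natval_norm_gt0 vb.
split; first exact: subring_scale ab Sb.
exact: (subring_scaleV HS a0 b0 ba SVb).
Qed.

Lemma unit_classes_val S a : convex_subring S -> a != 0 ->
  (Some @` unit_classes S) (v a) <-> S a /\ S a^-1.
Proof.
move=> HS a0; have [g va] := vmap_neq0 v a0.
by rewrite -(unit_classesP HS va) va; split=> [[h Hh [<-]]|].
Qed.

Lemma unit_classes_convex S : convex_subring S -> convex_subgroup (unit_classes S).
Proof.
move=> HS; have [S1 SB SM Sc] := HS; split.
- by exists 1; rewrite invr1 (vmap1 v).
- move=> g h [a [Sa SVa va]] [b [Sb SVb vb]]; exists (a / b).
  rewrite invfM invrK (vmapM v); split; [exact: SM|exact: SM|].
  have b0 : b != 0 by apply/eqP => b0; move: vb; rewrite b0 vmap0.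
  have := vmapV v b0; rewrite va vb; case: (v b^-1) => // k /= [] kh.
  by congr (Some (_ + _)); apply/eqP; rewrite -addr_eq0 kh.
(* A smaller value means a larger element: [c] is bounded by a multiple of [a], and [c^-1] by a
   multiple of [b^-1]. *)
- move=> g h k [a [Sa SVa va]] [b [Sb SVb vb]] /andP[gk kh].
  have [c vc] := vmap_surj k; exists c.
  have c0 := natval_norm_gt0 vc.
  have b0 := natval_norm_gt0 vb.
  have [n ca] : exists n, `|c| <= n%:R * `|a| by apply/natval_le; rewrite va vc.
  have [m bc] : exists m, `|b| <= m%:R * `|c| by apply/natval_le; rewrite vb vc.
  split=> //; first exact: subring_scale ca Sa.
  exact: (subring_scaleV HS c0 b0 bc SVb).
Qed.

(** The valuation is the quotient of [v] by the unit classes of [S]. A nonnegative value in the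
    quotient says that [v a] is at least [v b^-1] for some unit [b] of [S], which bounds [a] by a
    multiple of [b^-1]. *)
Lemma coarsening_exists S : convex_subring S ->
  exists w : valuation K, vringset w = S.
Proof.
move=> HS; have [U0 UB Uc] := unit_classes_convex HS.
pose P : {pred vgroup v} := fun g => `[< unit_classes S g >].
have Pclosed : zmod_closed P.
  split; first exact/asboolP.
  by move=> g h /asboolP Ug /asboolP Uh; apply/asboolP; apply: UB.
pose PM := GRing.isZmodClosed.Build _ P Pclosed.
pose H : zmodClosed (vgroup v) := HB.pack P PM.
have Hc g k : g \in H -> 0 <= k <= g -> k \in H.
  by move=> /asboolP Ug gk; apply/asboolP; apply: Uc gk.
exists (coarse_valuation Hc); apply/seteqP; split=> a.
  move/coarse_vringP=> [k /asboolP[b [Sb SVb vb]] ka].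
  have b0 : b != 0 by apply/eqP => b0; move: vb; rewrite b0 vmap0.
  have [n] : exists n, `|a| <= n%:R * `|b^-1|.
    apply/natval_le; move: ka; have := vmapV v b0; rewrite vb /=.
    case: (natmap b^-1) => // l [] /eqP; rewrite addr_eq0 => /eqP -> //.
  by move=> ab; apply: subring_scale ab _.
(* An element of [S] need not be a unit, but |a| + 1 is one, being at least 1, and its value is at
   most that of [a]. *)
move=> Sa; pose b := `|a| + 1.
have b1 : 1 <= b by rewrite lerDr.
have Sb : S b by apply: subringD (subring_norm HS Sa) _; case: HS.
have b0 : b != 0 by rewrite gt_eqF // (lt_le_trans ltr01).
have [k vb] := vmap_neq0 v b0.
apply/coarse_vringP; exists (- k).
  rewrite rpredN; apply/asboolP; exists b; split=> //.
  exact: subring_inv.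
rewrite opprK -vb; apply/natval_le; exists 1; rewrite mul1r.
by rewrite (ger0_norm (le_trans ler01 b1)) lerDl.
Qed.

(** If |a| <= |b| with [b] nonzero, then [a / b] is finite, so it lies in the ring of [w], and so
    does [a = (a / b) * b]. *)
Lemma coarsening_convex w : vringset v `<=` vringset w ->
  convex_subring (vringset w).
Proof.
move=> vw; have [R1 RB RM] := vring_subring w; split=> // a b Rb ab.
have [b0|b0] := eqVneq b 0.
  by move: ab; rewrite b0 normr0 normr_le0 => /eqP ->; rewrite -b0.
rewrite -(divfK b0 a); apply: RM => //; apply: vw; apply/natval_vringP; exists 1.
by rewrite normf_div ler_pdivrMr ?mul1r ?normr_gt0.
Qed.

Lemma vunitP w a : w a = Some 0 <-> [/\ a != 0, vringset w a & vringset w a^-1].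
Proof.
rewrite /vringset /= !in_vring; split=> [wa|[a0]].
  have a0 : a != 0 by apply/eqP => a0; move: wa; rewrite a0 vmap0.
  have := vmapV w a0; rewrite wa; split=> //; rewrite ?vlexx //.
  by case: (w a^-1) H => // g /=; rewrite addr0 => -[->].
have := vmapV w a0; case: (w a) (w a^-1) => [g|] [h|] //= [hg] g0 h0.
congr Some; apply/le_anti; rewrite g0 andbT.
by have := ogroup_leD2r g h0; rewrite hg add0r.
Qed.

Lemma vsubgroupE w : vsubgroup w = unit_classes (vringset w).
Proof.
apply/seteqP; split=> g [a]; first by move=> [/vunitP[a0 Ra RVa] va]; exists a.
move=> [Ra RVa va]; exists a; split=> //; apply/vunitP; split=> //.
by apply/eqP => a0; move: va; rewrite a0 vmap0.
Qed.

Lemma pos_unitsE w :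
  pos_units w = [set a | [/\ vringset w a, vringset w a^-1 & 0 < a]].
Proof.
apply/seteqP; split=> a; first by move=> [/vunitP[a0 Ra RVa] a_gt0]; split.
by move=> [Ra RVa a0]; split=> //; apply/vunitP; rewrite gt_eqF.
Qed.

Lemma rankE S : rank K S <-> convex_subring S /\ S <> vringset v.
Proof.
split=> [[w [-> [vw wv]]]|[HS Sv]]; first by split=> //; apply: coarsening_convex.
have [w wS] := coarsening_exists HS; exists w; rewrite /proper_coarsening wS.
by split=> //; split=> //; apply: natval_sub.
Qed.

End ConvexSubrings.

(** * Convex hulls of growing sequences *)

Section Hull.
Variable K : realFieldType.
Local Notation v := (natval K).
Implicit Types (a b c : K) (S : set K) (s : nat -> K).

Definition hull s : set K := [set a | exists n, `|a| <= s n].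

(** These conditions make [hull s] a ring: since [s] increases, two elements share a bound [s n],
    and a later term dominates both its double and its square. *)
Definition growing s :=
  [/\ 1 <= s 0, (forall n, s n <= s n.+1),
      (forall n, exists m, s n + s n <= s m)
    & forall n, exists m, s n * s n <= s m].

Lemma growing_le s m n : growing s -> (m <= n)%N -> s m <= s n.
Proof.
by case=> _ s_incr _ _; apply: (homo_leq (@lexx _ _) (@le_trans _ _)) => n'.
Qed.

Lemma growing_ge1 s n : growing s -> 1 <= s n.
Proof. by move=> gs; apply: le_trans (growing_le gs (leq0n n)); case: gs. Qed.

Lemma growing_hull s n : growing s -> hull s (s n).
Proof.
by move=> gs; exists n; rewrite ger0_norm // (le_trans ler01) ?growing_ge1.
Qed.

Lemma hull_subring s : growing s -> convex_subring (hull s).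
Proof.
move=> gs; have [_ _ sD sM] := gs.
have both a b : hull s a -> hull s b -> exists n, `|a| <= s n /\ `|b| <= s n.
  move=> [m am] [n bn]; exists (maxn m n).
  by rewrite (le_trans am) ?(le_trans bn) ?growing_le ?leq_maxl ?leq_maxr.
split; first by exists 0%N; rewrite normr1 growing_ge1.
- move=> a b Sa Sb; have [n [an bn]] := both _ _ Sa Sb; have [m nm] := sD n.
  exists m; apply: le_trans nm; apply: le_trans (ler_normB _ _) _.
  exact: lerD.
- move=> a b Sa Sb; have [n [an bn]] := both _ _ Sa Sb; have [m nm] := sM n.
  by exists m; apply: le_trans nm; rewrite normrM ler_pM.
- by move=> a b [n bn] ab; exists n; apply: le_trans bn.
Qed.

Lemma hull_cofinal s : hull s = setT <-> cofinal s.
Proof.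
split=> [sT x|cs]; last by apply/seteqP; split=> // x _; apply: cs.
have [n xn] : hull s x by rewrite sT.
by exists n; apply: le_trans xn; apply: ler_norm.
Qed.

(** Bounding [a] and [a^-1] by [b] traps [v a] between [v b] and [- v b], both of which lie in
    [H]. *)
Lemma convex_subgroup_val (H : set (vgroup v)) a b : convex_subgroup H ->
  a != 0 -> `|a| <= b -> `|a^-1| <= b -> (Some @` H) (v b) -> (Some @` H) (v a).
Proof.
case=> H0 HB Hc a0 ab aVb [h Hh vb].
have b0 : 0 <= b by apply: le_trans ab.
have vle_b c : `|c| <= b -> vle (v b) (v c).
  by move=> cb; apply/natval_le; exists 1; rewrite mul1r (ger0_norm b0).
have [g va] := vmap_neq0 v a0.
rewrite va; exists g => //.
have := vle_b _ ab; have := vle_b _ aVb; have := vmapV v a0.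
rewrite -vb va; case: (v a^-1) => //= g' [] /eqP; rewrite addr_eq0 => /eqP -> hg' hg.
apply: (Hc h (0 - h)) => //; first exact: HB.
rewrite hg sub0r /=.
have := ogroup_leD2r (g - h) hg'.
by rewrite addKr addrCA subrr addr0.
Qed.

Lemma positive_infinite_gt a n : positive_infinite a -> n%:R < a.
Proof.
move=> [a0 aI]; rewrite ltNge; apply/negP => an; case/negP: aI.
by apply/natval_vringP; exists n; rewrite gtr0_norm.
Qed.

Lemma positive_infinite_norm a : ~ vringset v a -> positive_infinite `|a|.
Proof.
move=> aI; split.
  rewrite normr_gt0; apply/eqP => a0; apply/aI/natval_vringP.
  by exists 0; rewrite a0 normr0.
apply/negP => /natval_vringP[n an]; apply/aI/natval_vringP; exists n.
by rewrite normr_id in an.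
Qed.

End Hull.

(* Abstracts a |-> (a^n) and a |-> (f^n(a)); [stable] is the condition on
   valuation rings, [closed] the one on convex subgroups. The bound 4 is n^2 for
   n = 2: beyond it a strong exponential dominates squaring. *)
Record growth (K : realFieldType) := Growth {
  orbit :> K -> nat -> K;
  stable : set K -> Prop;
  closed : set (vgroup (natval K)) -> Prop;
  orbit_le : forall a n, orbit a n <= orbit (`|a| + 5) n;
  orbit_growing : forall a, 4 < a -> growing (orbit a);
  orbit_mem : forall a, 4 < a -> hull (orbit a) a;
  orbit_stable : forall a, 4 < a -> stable (hull (orbit a));
  stable_orbit : forall S a n, convex_subring S -> stable S -> S a ->
    S (orbit a n);
  stable_closed : forall S, convex_subring S -> stable S ->
    closed (unit_classes S);
  closed_orbit : forall H a n, convex_subgroup H -> closed H -> 4 < a ->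
    (Some @` H) (natval K a) -> (Some @` H) (natval K (orbit a n))
}.

(** * The rank attached to an abstract growth *)

Section GrowthRank.
Variables (K : realFieldType) (G : growth K).
Local Notation v := (natval K).
Implicit Types (a b c : K) (S R : set K).

Definition growth_principal (H : set (vgroup v)) := exists g,
  is_smallest [set H' | [/\ convex_subgroup H', H' g & closed G H']] H.

Definition growth_rank : set (set K) :=
  [set S | [/\ rank K S, stable G S & growth_principal (unit_classes S)]].

Lemma hull_orbit_sub S a : convex_subring S -> stable G S -> 4 < a -> S a ->
  hull (G a) `<=` S.
Proof.
move=> HS SS a4 Sa c [n cn]; apply: (subring_convex HS cn).
exact: stable_orbit.
Qed.

Lemma growth_principalP S : convex_subring S -> stable G S ->
  growth_principal (unit_classes S) <-> exists2 a, 4 < a & S = hull (G a).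
Proof.
move=> HS SS; have [S1 SB SM Sc] := HS; split=> [[g [[_ Sg _] Smin]]|[a a4 Sa]].
  have [b [Sb SVb vb]] := Sg.
  (* The sum dominates both [b] and [b^-1], so [b] becomes a unit of the hull of [a] and minimality
     applies to the unit classes of that hull; the 5 ensures [4 < a]. *)
  pose a := `|b| + `|b^-1| + 5.
  have a4 : 4 < a.
    by rewrite (lt_le_trans (y := 5)) ?ltr_nat // lerDr addr_ge0.
  have Sa : S a.
    apply: (subringD HS); last exact: subring_nat.
    by apply: (subringD HS); apply: subring_norm.
  have gr := orbit_growing G a4; have TS := hull_subring gr.
  have Ta := orbit_mem G a4.
  exists a => //; apply/seteqP; split; last exact: hull_orbit_sub.
  have sub : unit_classes S `<=` unit_classes (hull (G a)).
    apply: Smin; split; first exact: unit_classes_convex.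
      exists b; split=> //; apply: (subring_convex TS _ Ta); rewrite /a.
        by rewrite -addrA lerDl addr_ge0.
      by rewrite addrAC lerDr addr_ge0.
    by apply: stable_closed => //; apply: orbit_stable.
  (* The inclusion just obtained concerns units only, so [c] is replaced by the unit |c| + 1, which
     bounds it. *)
  move=> c Sc'; pose d := `|c| + 1.
  have d1 : 1 <= d by rewrite lerDr.
  have Sd : S d by apply: (subringD HS) => //; apply: subring_norm.
  have d0 : d != 0 by rewrite gt_eqF // (lt_le_trans ltr01).
  have [h vd] := vmap_neq0 v d0.
  have [|Td _] := (unit_classesP TS vd).1.
    by apply: sub; exists d; split=> //; apply: subring_inv.
  by apply: (subring_convex TS _ Td); rewrite lerDl.
(* Conversely, the class of [a] is the generator: a unit of the hull and its inverse are both
   bounded by one term of the orbit, whose value lies in every closed convex subgroup containing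
   [v a]. *)
have Sa' : S a by rewrite Sa; apply: orbit_mem.
have a1 : 1 <= a by rewrite (le_trans _ (ltW a4)) // ler1n.
have a0 : a != 0 by rewrite gt_eqF // (lt_le_trans ltr01).
have [g va] := vmap_neq0 v a0; exists g; split.
  split; [exact: unit_classes_convex| |exact: stable_closed].
  by exists a; split=> //; apply: subring_inv.
move=> H [HH Hg QH] h [c [Sc' SVc vc]].
have c0 : c != 0 by rewrite -normr_gt0; apply: natval_norm_gt0 vc.
move: Sc' SVc; rewrite Sa => -[m cm] [n cn].
have gr := orbit_growing G a4.
have : (Some @` H) (v c).
  apply: (@convex_subgroup_val _ _ _ (G a (maxn m n))) => //.
  - by rewrite (le_trans cm) // growing_le ?leq_maxl.
  - by rewrite (le_trans cn) // growing_le ?leq_maxr.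
  - by apply: closed_orbit => //; rewrite va; exists g.
by rewrite vc => -[k Hk [<-]].
Qed.

Lemma growth_rankP S : growth_rank S <->
  [/\ convex_subring S, S <> vringset v, stable G S
    & exists2 a, 4 < a & S = hull (G a)].
Proof.
split=> [[/rankE[HS Sv] SS /(growth_principalP HS SS)]|[HS Sv SS]] //.
by move/(growth_principalP HS SS) => Sp; split=> //; apply/rankE.
Qed.

Lemma growth_rank_hull a : positive_infinite a -> growth_rank (hull (G a)).
Proof.
move=> a_inf; have a4 : 4 < a := positive_infinite_gt 4 a_inf.
apply/growth_rankP; split; last by exists a.
- exact: hull_subring (orbit_growing G a4).
- move=> av; case/negP: a_inf.2.
  by have := orbit_mem G a4; rewrite av.
- exact: orbit_stable.
Qed.

(** The unique member [R] is the hull of every positive infinite element. Hence it contains the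
    absolute value of each infinite element, and it contains the finite elements like any convex
    subring. *)
Lemma growth_rank_singletonT :
  (exists R, growth_rank = [set R]) -> growth_rank = [set setT].
Proof.
move=> [R rR]; rewrite rR; congr set1; apply/seteqP; split=> // c _.
have hull_R a : positive_infinite a -> hull (G a) = R.
  by move=> /growth_rank_hull; rewrite rR.
have /growth_rankP[HR _ _ _] : growth_rank R by rewrite rR.
have [/(natval_sub HR)//|cI] := pselect (vringset v c).
have c_inf := positive_infinite_norm cI.
apply: (subring_convex HR (lexx _)); rewrite -(hull_R _ c_inf).
exact/orbit_mem/(positive_infinite_gt 4).
Qed.

Lemma growth_rank_singletonP : ~ Num.archimedean_axiom K ->
  (exists R, growth_rank = [set R]) <->
  (forall a, positive_infinite a -> cofinal (G a)).
Proof.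
move=> nonarch; split=> [/growth_rank_singletonT rT a a_inf|cof].
  by apply/hull_cofinal; have := growth_rank_hull a_inf; rewrite rT.
have hullT a : positive_infinite a -> hull (G a) = setT.
  by move=> /cof/hull_cofinal.
exists setT; apply/seteqP; split=> [S /growth_rankP[HS Sv SS _]|S ->]; last first.
  (* An infinite element is needed for [K] itself to be a member; it exists because [K] is
     nonarchimedean. *)
  have [c cI] : exists c, ~ vringset v c.
    apply/not_existsP => all_fin; apply: nonarch => x.
    have /natval_vringP[n xn] := contrapT (all_fin x).
    by exists n.+1; apply: le_lt_trans xn _; rewrite ltr_nat.
  have c_inf := positive_infinite_norm cI.
  by rewrite -(hullT _ c_inf); apply: growth_rank_hull.
apply/seteqP; split=> // c _.
(* Any member differs from the ring of [v], so it contains some infinite [d], and with it the hull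
   of |d|, which is all of [K]. *)
have [d [Sd dI]] : exists d, S d /\ ~ vringset v d.
  apply/not_existsP => no; apply: Sv; apply/seteqP; split; last exact: natval_sub.
  by move=> d Sd; apply: contrapT => dI; apply: (no d).
have d_inf := positive_infinite_norm dI.
apply: (hull_orbit_sub HS SS (positive_infinite_gt 4 d_inf)).
  exact: subring_norm.
by rewrite hullT.
Qed.

End GrowthRank.

(** * Cofinal sequences in the residue field *)

Section Residue.
Variables (K : realFieldType) (w : convex_valuation K).
Local Notation v := (natval K).
Local Notation Kw := (residue_field w).
Implicit Types (a b c : K) (x y : Kw).

Lemma res_vring a (aR : a \in vring w) : res w a = rpi (Sub a aR).
Proof. by rewrite /res insubT. Qed.

Lemma res_surj x : exists2 a, vringset w a & res w a = x.
Proof.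
exists (val (repr x)); first exact: valP.
rewrite res_vring ?(valP (repr x)) // => xR.
by rewrite -[RHS]rpiK; congr rpi; apply/val_inj.
Qed.

Lemma res1 : res w 1 = 1.
Proof.
by rewrite (res_vring (rpred1 _)) -rpi1; congr rpi; apply/val_inj.
Qed.

Lemma resD a b : vringset w a -> vringset w b -> res w (a + b) = res w a + res w b.
Proof.
move=> aR bR; rewrite (res_vring aR) (res_vring bR) (res_vring (rpredD aR bR)).
by rewrite -rpiD; congr rpi; apply/val_inj; rewrite rmorphD.
Qed.

Lemma resM a b : vringset w a -> vringset w b -> res w (a * b) = res w a * res w b.
Proof.
move=> aR bR; rewrite (res_vring aR) (res_vring bR) (res_vring (rpredM aR bR)).
by rewrite -rpiM; congr rpi; apply/val_inj; rewrite rmorphM.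
Qed.

Lemma resX a n : vringset w a -> res w (a ^+ n) = res w a ^+ n.
Proof.
move=> aR; elim: n => [|n IH]; first by rewrite !expr0 res1.
by rewrite !exprS resM ?IH //; apply: rpredX.
Qed.

Lemma convex_valuation_subring : convex_subring (vringset w).
Proof.
have [R1 RB RM] := vring_subring w; split=> // a b bR ab.
have bR' : `|b| \in vring w by case: (ger0P b); rewrite ?rpredN.
apply: (cvaluation_convex (c := w) (a := - `|b|) (b := `|b|)) => //.
  by rewrite /vringset /= rpredN.
by rewrite -ler_norml.
Qed.

(** The residue map is monotone and onto, so a bound by the orbit of [a] in the ring of [w] passes
    to residues. Lifting a bound back costs a margin of 1, because the order of residues ignores
    infinitesimals of [w]. *)
Lemma residue_cofinalP (G : growth K) (sigma : Kw -> nat -> Kw) :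
  stable G (vringset w) ->
  (forall a n, vringset w a -> sigma (res w a) n = res w (G a n)) ->
  (exists x, cofinal (sigma x)) <->
  exists2 a, 4 < a & vringset w = hull (G a).
Proof.
move=> SR sigmaE; have HR := convex_valuation_subring.
have orbitR a n : vringset w a -> vringset w (G a n) by move=> ?; apply: stable_orbit.
split=> [[x]|[a a4 Ra]]; last first.
  have aR : vringset w a by rewrite Ra; apply: orbit_mem.
  exists (res w a) => y; have [c cR <-] := res_surj y.
  have [n cn] : hull (G a) c by rewrite -Ra.
  exists n; rewrite sigmaE //; apply: le_res => //; first exact: orbitR.
  exact: le_trans (ler_norm _) cn.
have [b bR <-] := res_surj x => cof.
(* The lift [b] of a cofinal residue may be negative or small; |b| + 5 exceeds 4 and its orbit lies
   above that of [b]. *)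
have aR : vringset w (`|b| + 5).
  by apply: (subringD HR); [apply: subring_norm|apply: subring_nat].
have a4 : 4 < `|b| + 5 by rewrite (lt_le_trans (y := 5)) ?ltr_nat // lerDr.
exists (`|b| + 5) => //; apply/seteqP; split; last exact: hull_orbit_sub.
move=> c cR; have cR' := subring_norm HR cR.
have [n] := cof (res w (`|c| + 1)); rewrite sigmaE // => cn; exists n.
(* If |c| exceeded the term of the larger orbit, the residue of |c| + 1 would be at most that of
   |c|, giving [1 <= 0] in the residue field. *)
rewrite leNgt; apply/negP => nc.
have : res w (`|c| + 1) <= res w `|c|.
  apply: (le_trans cn); apply: le_res; [exact: orbitR|exact: cR'|].
  by apply: le_trans (orbit_le G b n) _; apply: ltW.
by rewrite resD // ?res1 ?gerDl ?ler10 //; apply: rpred1.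
Qed.

End Residue.

(** * The growth given by powers *)

Section Powers.
Variable K : realFieldType.
Local Notation v := (natval K).
Implicit Types (a b c : K) (S : set K).

Lemma gt4_ge1 a : 4 < a -> 1 <= a.
Proof. by move=> a4; rewrite (le_trans _ (ltW a4)) // ler1n. Qed.

Lemma power_le a n : a ^+ n <= (`|a| + 5) ^+ n.
Proof.
apply: (le_trans (ler_norm _)); rewrite normrX.
by rewrite lerXn2r ?nnegrE ?addr_ge0 // lerDl.
Qed.

Lemma power_growing a : 4 < a -> growing (fun n => a ^+ n).
Proof.
move=> a4; have a1 := gt4_ge1 a4; have a0 : 0 <= a := le_trans ler01 a1.
split=> [|n|n|n]; first by rewrite expr0.
- by rewrite exprS ler_peMl // exprn_ge0.
- exists n.+1; rewrite -mulr2n -mulr_natl exprS ler_wpM2r ?exprn_ge0 //.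
  by rewrite (le_trans _ (ltW a4)) // ler_nat.
- by exists (n + n)%N; rewrite exprD.
Qed.

Lemma power_mem a : 4 < a -> hull (fun n => a ^+ n) a.
Proof. by move/power_growing/(growing_hull 1); rewrite expr1. Qed.

Lemma power_subring S a n : convex_subring S -> S a -> S (a ^+ n).
Proof.
move=> [S1 _ SM _] Sa; elim: n => [|n IH]; first by rewrite expr0.
by rewrite exprS; apply: SM.
Qed.

Lemma power_class (H : set (vgroup v)) a n : convex_subgroup H ->
  (Some @` H) (v a) -> (Some @` H) (v (a ^+ n)).
Proof.
move=> [H0 HB _] [g Hg va]; elim: n => [|n [h Hh vh]].
  by rewrite expr0 (vmap1 v); exists 0.
rewrite exprS (vmapM v) -va -vh; exists (g + h) => //.
by rewrite -[h]opprK; apply: (HB) => //; rewrite -sub0r; apply: HB.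
Qed.

Definition power_growth : growth K :=
  @Growth K (fun a n => a ^+ n) (fun=> True) (fun=> True)
    power_le power_growing power_mem (fun _ _ => I)
    (fun S a n HS _ => @power_subring S a n HS) (fun _ _ _ => I)
    (fun H a n HH _ _ => @power_class H a n HH).

Lemma principal_rankE : principal_rank K = growth_rank power_growth.
Proof.
(* The two notions of principality differ only by the closure condition, which is [True] for
   powers. *)
have pE H : principal H <-> growth_principal power_growth H.
  have -> // : @principal K = growth_principal power_growth.
  apply/funext => H'; rewrite /principal /growth_principal.
  congr (exists g, _); apply/funext => g; congr (is_smallest _ _).
  by apply/seteqP; split=> H'' /= [? ?].
apply/seteqP; split=> S.
  by move=> [w [-> rS pS]]; split=> //; apply/pE; rewrite -vsubgroupE.
move=> [rS _ pS]; have [w [Sw _]] := rS; exists w; split=> //.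
by apply/pE; rewrite vsubgroupE -Sw.
Qed.

End Powers.

(** * The growth given by iterating a strong exponential *)

Section Exponentials.
Variables (K : realFieldType) (f : K -> K).
Hypotheses (f_exp : exponential f) (f_strong : strong f).
Local Notation v := (natval K).
Implicit Types (a b c : K) (S : set K).

Lemma exponential_gt0 a : 0 < f a. Proof. by case: f_exp => /(_ a). Qed.

Lemma exponential_le a b : (f a <= f b) = (a <= b).
Proof. by case: f_exp => _ _ _ fl; rewrite !leNgt fl. Qed.

Lemma exponentialN a : f (- a) = (f a)^-1.
Proof.
case: f_exp => _ _ fD _; have f_neq0 b : f b != 0 by rewrite gt_eqF ?exponential_gt0.
have f0 : f 0 = 1.
  by apply: (mulfI (f_neq0 0)); rewrite -fD addr0 mulr1.
by apply: (mulfI (f_neq0 a)); rewrite -fD subrr f0 mulfV.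
Qed.

Lemma strong_sqr a : 4 < a -> a * a < f a.
Proof. by move=> a4; rewrite -expr2; apply: f_strong; rewrite -natrX. Qed.

Lemma strong_gt a : 4 < a -> a < f a.
Proof.
move=> a4; apply: le_lt_trans (strong_sqr a4).
by rewrite ler_peMl ?(le_trans ler01) ?gt4_ge1.
Qed.

Lemma iter_gt4 a n : 4 < a -> 4 < iter n f a.
Proof.
by move=> a4; elim: n => //= n IH; apply: lt_trans (strong_gt IH).
Qed.

Lemma iter_le a b n : a <= b -> iter n f a <= iter n f b.
Proof. by move=> ab; elim: n => //= n IH; rewrite exponential_le. Qed.

Lemma orbit_exp_le a n : iter n.+1 f a <= iter n.+1 f (`|a| + 5).
Proof. by apply: iter_le; rewrite (le_trans (ler_norm a)) // lerDl. Qed.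

(** The next iterate suffices throughout: beyond 4, [b + b <= b * b < f b]. The sequence starts at
    [f a], so index [n] carries the iterate [n.+1]. *)
Lemma exp_growing a : 4 < a -> growing (fun n => iter n.+1 f a).
Proof.
move=> a4; split=> [|n|n|n].
- exact/gt4_ge1/(iter_gt4 1).
- exact/ltW/strong_gt/(iter_gt4 n.+1).
- have b4 := iter_gt4 n.+1 a4; exists n.+1.
  apply: le_trans (ltW (strong_sqr b4)); rewrite -mulr2n -mulr_natl.
  by rewrite ler_wpM2r ?(le_trans ler01) ?gt4_ge1 // (le_trans _ (ltW b4)) // ler_nat.
- by exists n.+1; apply/ltW/strong_sqr/(iter_gt4 n.+1).
Qed.

Lemma exp_mem a : 4 < a -> hull (fun n => iter n.+1 f a) a.
Proof.
move=> a4; exists 0%N; rewrite ger0_norm ?(le_trans ler01) ?gt4_ge1 //.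
exact/ltW/strong_gt.
Qed.

(** The condition that [f] maps a valuation ring onto its positive units, phrased for a bare set;
    [pos_unitsE] translates. *)
Definition exp_stable S := f @` S = [set a | [/\ S a, S a^-1 & 0 < a]].

Lemma exp_hull_stable a : 4 < a -> exp_stable (hull (fun n => iter n.+1 f a)).
Proof.
move=> a4; set T := hull _; have HT : convex_subring T.
  exact/hull_subring/exp_growing.
have fT b : T b -> T (f b).
  move=> [n bn]; exists n.+1.
  rewrite gtr0_norm ?exponential_gt0 // [leRHS]iterS exponential_le.
  exact: le_trans (ler_norm _) bn.
apply/seteqP; split=> [_ [b Tb <-]|b [Tb TVb b0]].
  split; [exact: fT|rewrite -exponentialN; apply: fT|exact: exponential_gt0].
  by rewrite -sub0r; case: (HT) => _ TB _ _; apply: TB => //; apply: subring0.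
(* The logarithm [c] of a positive unit [b] stays in the hull: either |c| is at most 4, or |c| is
   below [f] of |c|, which is [b] or [b^-1]. *)
have [c fc] : exists c, f c = b by case: f_exp => _ + _ _; apply.
exists c => //; have [c4|c4] := leP `|c| 4.
  by apply: (subring_convex HT c4); apply: (subring_nat HT 4).
apply: (subring_convex HT (ltW (strong_gt c4))).
by case: (ger0P c) => _; rewrite ?exponentialN fc.
Qed.

Lemma exp_stable_orbit S a n : convex_subring S -> exp_stable S -> S a ->
  S (iter n.+1 f a).
Proof.
move=> HS SS Sa.
have fS b : S b -> S (f b).
  by move=> Sb; have : (f @` S) (f b) by [exists b]; rewrite SS => -[].
by elim: n => [|n IH]; [exact: fS|rewrite iterS; apply: fS].
Qed.

Lemma exp_stable_closed S : convex_subring S -> exp_stable S ->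
  exp_closed f (unit_classes S).
Proof.
move=> HS SS a vaS; have a0 : a != 0.
  by apply/eqP => a0; move: vaS; rewrite a0 (vmap0 v) => -[].
have [Sa _] := (unit_classes_val HS a0).1 vaS.
have : (f @` S) (f a) by exists a.
by rewrite SS => -[Sfa SVfa _]; apply/unit_classes_val; rewrite ?gt_eqF ?exponential_gt0.
Qed.

Lemma exp_closed_orbit (H : set (vgroup v)) a n : exp_closed f H ->
  (Some @` H) (v a) -> (Some @` H) (v (iter n.+1 f a)).
Proof.
move=> Hf Ha; elim: n => [|n IH]; first exact: Hf.
by rewrite iterS; apply: Hf.
Qed.

Definition exp_growth : growth K :=
  @Growth K (fun a n => iter n.+1 f a) exp_stable (exp_closed f)
    orbit_exp_le
    exp_growing exp_mem exp_hull_stable exp_stable_orbit exp_stable_closed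
    (fun H a n _ Hf _ => exp_closed_orbit n Hf).

Lemma principal_exp_rankE : principal_exp_rank f = growth_rank exp_growth.
Proof.
apply/seteqP; split=> S.
  (* The exponential rank may be witnessed by a valuation [w'] other than [w]; both have the same
     ring, which determines the positive units. *)
  move=> [w [-> [w' [ww' rS fS]] pS]]; split=> //; last by rewrite -vsubgroupE.
  by rewrite /= /exp_stable fS pos_unitsE ww'.
move=> [rS SS pS]; have [w [Sw _]] := rS; exists w; split=> //.
  by exists w; split=> //; rewrite pos_unitsE -Sw.
by rewrite vsubgroupE -Sw.
Qed.

End Exponentials.

(** * Cofinality criteria for the principal and principal exponential ranks *)

Theorem theorem2 (K : realFieldType) (nonarch : ~ Num.archimedean_axiom K)
    (w : convex_valuation K) (w_neq_v : vringset w <> vringset (natval K)) :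
  (* a) *)
  [/\ principal_rank K (vringset w) <->
        (exists b : residue_field w, cofinal (fun n => b ^+ n)),
      (exists R, principal_rank K = [set R]) <->
        (forall a : K, positive_infinite a -> cofinal (fun n => a ^+ n))
    & (exists R, principal_rank K = [set R]) ->
        principal_rank K = [set [set: K]]] /\
  (* b) *)
  (forall f : K -> K, strong f -> T1_exponential f -> compatible w f ->
  [/\ principal_exp_rank f (vringset w) <->
        (exists b : residue_field w,
           cofinal (fun n => iter n.+1 (induced_exp w f) b)),
      (exists R, principal_exp_rank f = [set R]) <->
        (forall a : K, positive_infinite a -> cofinal (fun n => iter n.+1 f a))
    & (exists R, principal_exp_rank f = [set R]) ->
        principal_exp_rank f = [set [set: K]]]).
Proof.
(* Both residue field criteria reduce to this one: membership and cofinality each say that the ring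
   of [w] is the hull of some [a] above 4. *)
have growth_rank_w (G : growth K) (sigma : residue_field w -> nat -> residue_field w) :
    stable G (vringset w) ->
    (forall a n, vringset w a -> sigma (res w a) n = res w (G a n)) ->
    growth_rank G (vringset w) <-> exists b, cofinal (sigma b).
  move=> SR sigmaE; rewrite (residue_cofinalP SR sigmaE) growth_rankP.
  by split=> [[]|] //; split=> //; apply: convex_valuation_subring.
split=> [|f f_strong [f_exp _ _] wf].
  rewrite principal_rankE; split.
  - apply: (growth_rank_w (power_growth K) (fun b n => b ^+ n)) => // a n aR.
    by rewrite resX.
  - exact: growth_rank_singletonP.
  - exact: growth_rank_singletonT.
have SR : exp_stable f (vringset w) by rewrite /exp_stable wf.1 pos_unitsE.
rewrite (principal_exp_rankE f_exp f_strong); split.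
- apply: (growth_rank_w (exp_growth f_exp f_strong)
    (fun b n => iter n.+1 (induced_exp w f) b)) => // a n aR /=.
  (* Iterates of the induced exponential are residues of iterates of [f]; [induced_expE] applies at
     each stage because the orbit stays in the ring of [w]. *)
  elim: n => [|n IH]; first exact: induced_expE.
  rewrite iterS IH; apply: induced_expE => //.
  exact: exp_stable_orbit (convex_valuation_subring w) SR aR.
- exact: growth_rank_singletonP.
- exact: growth_rank_singletonT.
Qed.
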